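(* Let $\alpha,\lambda,m,n$ be positive integers. If $\lambda mK_n$ admits an $\alpha$-resolvable $(c_1,\ldots,c_k)$-cycle decomposition, then $\lambda K_{n\times m}$ admits an $\alpha$-resolvable $(c_1m,\ldots,c_km)$-cycle decomposition.
   Context: $\lambda K_n$: complete multigraph on $n$ vertices with $\lambda$ parallel edges between each pair; $\lambda K_{n\times m}$: complete $\lambda$-fold $n$-partite multigraph with $n$ parts of size $m$. A cycle decomposition of $\mathcal{G}$ is an edge-partition into cycles (or into cycles and a single 1-factor if every vertex has odd degree); a $(c_1,\ldots,c_k)$-cycle decomposition has $k$ cycles of lengths $c_1,\ldots,c_k$. It is $\alpha$-resolvable if the cycles can be partitioned into classes such that each vertex lies in exactly $\alpha$ cycles of each class. *)

(* Defs.v *)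
From mathcomp Require Import all_boot.

Set Implicit Arguments.
Unset Strict Implicit.
Unset Printing Implicit Defensive.

(* Finite loopless multigraphs: parallel edges are distinct elements of [edge]
   with the same set of end-vertices. *)
Record multigraph := Multigraph {
  vertex : finType;
  edge : finType;
  ends : edge -> {set vertex};
  card_ends : forall e, #|ends e| = 2
}.

Section LambdaFold.

Variables (lambda : nat) (V : finType) (P : pred {set V}).
Hypothesis P_card : forall A, P A -> #|A| = 2.

Definition lambda_fold_edge : finType := {p : {set V} * 'I_lambda | P p.1}.

Definition lambda_fold_ends (e : lambda_fold_edge) : {set V} := (val e).1.

Lemma card_lambda_fold_ends e : #|lambda_fold_ends e| = 2.
Proof. exact: P_card (valP e). Qed.

(* The [lambda]-fold of the simple graph on [V] with edge set [P]. *)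
Definition lambda_fold : multigraph := Multigraph card_lambda_fold_ends.

End LambdaFold.

Definition pair_edge (V : finType) : pred {set V} := fun A => #|A| == 2.

Lemma pair_edge_card (V : finType) (A : {set V}) : pair_edge A -> #|A| = 2.
Proof. exact: eqP. Qed.

Definition complete_multigraph (lambda n : nat) : multigraph :=
  lambda_fold lambda (@pair_edge_card 'I_n).

(* The [i]-th part of the equipartite graph is the set of pairs [(i, j)]. *)
Definition cross_edge (n m : nat) : pred {set 'I_n * 'I_m} :=
  fun A => (#|A| == 2) &&
    [forall x in A, forall y in A, (x != y) ==> (x.1 != y.1)].

Lemma cross_edge_card (n m : nat) (A : {set 'I_n * 'I_m}) :
  cross_edge A -> #|A| = 2.
Proof. by case/andP=> /eqP. Qed.

Definition complete_equipartite_multigraph (lambda n m : nat) : multigraph :=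
  lambda_fold lambda (@cross_edge_card n m).

Section CycleDecomposition.

Variable G : multigraph.

Definition degree (v : vertex G) : nat := #|[set e : edge G | v \in ends e]|.

Definition one_factor (F : {set edge G}) : Prop :=
  forall v : vertex G, #|[set e in F | v \in ends e]| = 1.

(* A cycle is identified with its edge set. Two parallel edges form a cycle of
   length 2, which is why the edges are required to be distinct. *)
Definition is_cycle (c : nat) (C : {set edge G}) : Prop :=
  1 < c /\
  exists (v : 'I_c -> vertex G) (e : 'I_c -> edge G),
    [/\ injective v, injective e,
        forall i, ends (e i) = [set v i; v (ordS i)]
      & C = [set e i | i : 'I_c]].

Definition on_cycle (v : vertex G) (C : {set edge G}) : bool :=
  [exists e in C, v \in ends e].

Definition cycle_decomposition (k : nat) (c : 'I_k -> nat)
    (C : 'I_k -> {set edge G}) : Prop :=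
  (forall i, is_cycle (c i) (C i)) /\
  exists F : {set edge G},
    (F = set0 \/ ((forall v : vertex G, odd (degree v)) /\ one_factor F)) /\
    (forall e : edge G, #|[set i | e \in C i]| + (e \in F) = 1).

Definition resolvable (alpha k : nat) (C : 'I_k -> {set edge G}) : Prop :=
  exists P : {set {set 'I_k}},
    partition P [set: 'I_k] /\
    forall B, B \in P ->
      forall v : vertex G, #|[set i in B | on_cycle v (C i)]| = alpha.

Definition admits_resolvable_cycle_decomposition (alpha k : nat)
    (c : 'I_k -> nat) : Prop :=
  exists C : 'I_k -> {set edge G},
    cycle_decomposition c C /\ resolvable alpha C.

End CycleDecomposition.

(* Main.v *)
Require Import Defs.
From mathcomp Require Import all_boot all_fingroup.

(* Colour the edges by the cycle containing them, the edges of the 1-factor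
   having their own colour [None]. The copy number of an edge between the parts
   [x] and [y] of the equipartite graph, together with [i + j mod m] for its
   ends [(x, i)] and [(y, j)], selects one of the [lambda * m] edges [xy] below;
   pulling the colouring back along this map gives every vertex [(x, i)] the
   same colour degrees as [x]. Each cycle colour thus forms a 2-regular graph,
   which may be disconnected.

   If it is, some [u] and [w] in the same part lie in different components of a
   colour [i], as its quotient is connected. Let [pi] be the exchange of [u] and
   [w]. For a permutation [s] of the edges at [u] such that [s e] has the colour
   of [pi e], exchanging the colours of [e] and [pi e] for all [e] in a cycle of
   [s] preserves all colour degrees. In a colour where [u] and [w] are
   connected, removing them leaves paths that match the two edges at [u] with
   the two edges at [w] (parity), and [s] is chosen compatible with these paths,
   so that connectivity survives the exchange. In colour [i] the choice is free,
   and the two edges at [u] can be put in different cycles of [s]; the exchange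
   then merges two components. So the number of connected pairs of vertices
   increases until all cycle colours are connected. *)

Set Implicit Arguments.
Unset Strict Implicit.
Unset Printing Implicit Defensive.

(** * Cycles as connected 2-regular edge sets *)

Section EdgeSets.

Variable G : multigraph.
Implicit Types (X : {set edge G}) (U : {set vertex G}) (u v w x y : vertex G)
  (a b e : edge G).

Definition incident X v := [set e in X | v \in ends e].

Definition adj X : rel (vertex G) :=
  fun v w => [exists e in X, ends e == [set v; w]].

Lemma ends_other e v :
  v \in ends e -> exists2 w, w != v & ends e = [set v; w].
Proof.
have /eqP/cards2P[x [y [xy ->]]] := card_ends e.
rewrite !inE => /orP[] /eqP->; first by exists y; rewrite // eq_sym.
by exists x; rewrite // setUC.
Qed.

Lemma adjP X v w :
  reflect (exists2 e, e \in X & ends e = [set v; w]) (adj X v w).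
Proof.
apply: (iffP exists_inP) => [[e eX /eqP]|[e eX eE]]; exists e => //.
exact/eqP.
Qed.

Lemma adj_edge X e v w :
  e \in X -> v \in ends e -> w \in ends e -> connect (adj X) v w.
Proof.
move=> eX /ends_other[x _ eE]; rewrite eE !inE => /orP[] /eqP->.
  exact: connect0.
by apply/connect1/adjP; exists e.
Qed.

Lemma connect_adj_sym X : connect_sym (adj X).
Proof.
by apply: sym_connect_sym => v w; apply/adjP/adjP => -[e eX eE]; exists e;
  rewrite // setUC.
Qed.

Lemma connect_adjS X X' :
  X \subset X' -> subrel (connect (adj X)) (connect (adj X')).
Proof.
move=> sXX'; apply: connect_sub => v w /adjP[e eX eE].
by apply/connect1/adjP; exists e; rewrite ?(subsetP sXX').
Qed.

Lemma incident_pair X v a b :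
  #|incident X v| = 2 -> a \in incident X v -> b \in incident X v -> a != b ->
  incident X v = [set a; b].
Proof.
move=> card2 aX bX ab; apply/eqP; rewrite eq_sym eqEcard card2 cards2 ab /=.
by rewrite andbT; apply/subsetP=> e /set2P[]->.
Qed.

(* Double counting of the incidences at [U]. *)
Lemma even_cut X U :
  (forall v, ~~ odd #|incident X v|) ->
  ~~ odd #|[set e in X | #|ends e :&: U| == 1]|.
Proof.
move=> evX.
have evU : ~~ odd (\sum_(v in U) #|incident X v|).
  by elim/big_ind: _ => // p q /negPf op /negPf oq; rewrite oddD op oq.
suff -> : odd #|[set e in X | #|ends e :&: U| == 1]|
  = odd (\sum_(v in U) #|incident X v|) by [].
transitivity (odd (\sum_(e in X) #|ends e :&: U|)).
  rewrite cardsE -sum1_card big_mkcondr !(big_morph odd oddD erefl).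
  apply: eq_bigr => e _.
  have: #|ends e :&: U| <= 2 by rewrite -(card_ends e) subset_leq_card ?subsetIl.
  by case: #|_| => [|[|[|]]].
congr odd.
transitivity (\sum_(e in X) \sum_(v in U | v \in ends e) 1).
  by apply: eq_bigr => e _; rewrite -sum1_card; apply: eq_bigl => v;
    rewrite inE andbC.
rewrite (exchange_big_dep (mem U)) //=; last by move=> ? ? _ /andP[].
apply: eq_bigr => v vU; rewrite -sum1_card; apply: eq_bigl => e.
by rewrite !inE vU.
Qed.

(** * Incidence and connectivity along a cycle *)

Section CycleData.

Variables (c : nat) (v : 'I_c -> vertex G) (e : 'I_c -> edge G).
Hypotheses (c_gt1 : 1 < c) (v_inj : injective v) (e_inj : injective e).
Hypothesis eE : forall i, ends (e i) = [set v i; v (ordS i)].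
Let C := [set e i | i : 'I_c].

Lemma ordS_neq (i : 'I_c) : ordS i != i.
Proof.
apply/eqP=> /(congr1 val) /=; have := ltn_ord i.
rewrite leq_eqVlt => /orP[/eqP ic|lt_ic].
  by rewrite ic modnn => i0; move: c_gt1; rewrite -ic -i0.
by rewrite modn_small // => /eqP; rewrite gtn_eqF.
Qed.

Lemma cycle_incident i : incident C (v i) = [set e i; e (ord_pred i)].
Proof.
apply/setP=> d; rewrite !inE; apply/andP/orP=> [[/imsetP[j _ ->]]|].
  rewrite eE => /set2P[] /v_inj ->; first by left.
  by right; rewrite ordSK.
by case=> /eqP->; rewrite imset_f // eE ?ord_predK !inE eqxx ?orbT.
Qed.

Lemma card_cycle_incident x : #|incident C x| = 2 * (x \in codom v).
Proof.
have [/codomP[i ->]|xv] := boolP (x \in codom v).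
  rewrite cycle_incident cards2 (inj_eq e_inj); have := ordS_neq (ord_pred i).
  by rewrite ord_predK => ->.
apply/eqP; rewrite muln0 cards_eq0 -subset0; apply/subsetP=> d.
rewrite !inE => /andP[/imsetP[j _ ->]].
by rewrite eE => /set2P[] xE; rewrite xE codom_f in xv.
Qed.

Lemma cycle_connected x y :
  x \in codom v -> y \in codom v -> connect (adj C) x y.
Proof.
have c_gt0 : 0 < c by apply: ltnW.
have from0 i : connect (adj C) (v (Ordinal c_gt0)) (v i).
  case: i => i ltic; elim: i ltic => [|i IHi] ltic.
    by rewrite (_ : Ordinal ltic = Ordinal c_gt0) ?connect0 //; apply: val_inj.
  apply: connect_trans (IHi (ltnW ltic)) _; apply/connect1/adjP.
  exists (e (Ordinal (ltnW ltic))); first exact: imset_f.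
  by rewrite eE; congr [set _; v _]; apply: val_inj; rewrite /= modn_small.
move=> /codomP[i ->] /codomP[j ->]; apply: connect_trans (from0 j).
by rewrite connect_adj_sym.
Qed.

End CycleData.

(** * Connected 2-regular edge sets are cycles *)

Section Connected2Regular.

Variables (X : {set edge G}) (U : {set vertex G}) (x0 : vertex G).
Hypotheses (x0U : x0 \in U)
  (card_incident : forall v, #|incident X v| = 2 * (v \in U))
  (connU : {in U &, forall v w, connect (adj X) v w}).

(** The sequences are total on [nat], with later values ignored, so that lengthening a path does not
    change its type. *)
Let simple_path l (v : nat -> vertex G) (e : nat -> edge G) :=
  [/\ v 0 \in U, {in leq^~ l &, injective v}
    & forall t, t < l -> e t \in X /\ ends (e t) = [set v t; v t.+1]].

Let mem_support e v : e \in X -> v \in ends e -> v \in U.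
Proof.
move=> eX ve; case: (boolP (v \in U)) (card_incident v) => // _ /eqP.
by rewrite muln0 cards_eq0 => /eqP/setP/(_ e); rewrite !inE eX ve.
Qed.

Let path_support l (v : nat -> vertex G) (e : nat -> edge G) t :
  simple_path l v e -> t <= l -> v t \in U.
Proof.
case=> v0 _ vE; case: t => // t /vE[eX eE].
by apply: mem_support eX _; rewrite eE !inE eqxx orbT.
Qed.

Let path_mem_ends l (v : nat -> vertex G) (e : nat -> edge G) i t :
  simple_path l v e -> i <= l -> t < l ->
  (v i \in ends (e t)) = (i == t) || (i == t.+1).
Proof.
move=> [_ v_inj vE] il tl; have [_ ->] := vE t tl; rewrite !inE.
by rewrite !(inj_in_eq v_inj) // /in_mem /= ltnW.
Qed.

(** By injectivity the last vertex lies on no path edge but [e l.-1], so one of its two edges in [X]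
    is still free. *)
Let next_edge l (v : nat -> vertex G) (e : nat -> edge G) :
  simple_path l v e ->
  exists d, [/\ d \in X, v l \in ends d & forall t, t < l -> d != e t].
Proof.
move=> sp; have vlU := path_support sp (leqnn l).
have /eqP/cards2P[a [b [ab abE]]] : #|incident X (v l)| = 2.
  by rewrite card_incident vlU.
have [aX av] : a \in X /\ v l \in ends a.
  by have := set21 a b; rewrite -abE inE => /andP.
have [bX bv] : b \in X /\ v l \in ends b.
  by have := set22 a b; rewrite -abE inE => /andP.
have [l_eq0|l_gt0] := posnP l; first by exists a; split => // t; rewrite l_eq0.
have other d : v l \in ends d -> d != e l.-1 -> forall t, t < l -> d != e t.
  move=> vd dl t tl; apply: contraNneq dl => dE; move: vd.
  by rewrite dE (path_mem_ends sp) // gtn_eqF //= => /eqP->.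
have [aE|ae] := eqVneq a (e l.-1).
  by exists b; split => //; apply: other => //; rewrite -aE eq_sym.
by exists a; split => //; apply: other.
Qed.

(** Both edges at each vertex of the path now lie on the closed walk. The vertex set is thus closed
    under adjacency and, by connectedness, equals [U]. For [l = 1] the cycle consists of two
    parallel edges. *)
Let closed_path l (v : nat -> vertex G) (e : nat -> edge G) d :
  simple_path l v e -> d \in X ->
  (forall t, t < l -> d != e t) -> 0 < l -> ends d = [set v l; v 0] ->
  is_cycle #|U| X.
Proof.
move=> sp dX de l_gt0 dE; have [_ v_inj vE] := sp.
pose v' (i : 'I_l.+1) := v i; pose e' (i : 'I_l.+1) := if i < l then e i else d.
have eE i : ends (e' i) = [set v' i; v' (ordS i)].
  rewrite /e' /v'; case: ltnP => [il|li] /=.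
    by rewrite modn_small //; case: (vE i il).
  have -> : i = l :> nat by apply/eqP; rewrite eqn_leq li -ltnS ltn_ord.
  by rewrite modnn.
have v'_inj : injective v'.
  by move=> i j /v_inj ij; apply/val_inj/ij; rewrite /in_mem /= -ltnS.
have e_lt i j : i < j -> j < l -> e i != e j.
  move=> ij jl; have il := ltn_trans ij jl; apply/eqP=> eij.
  have := path_mem_ends sp (ltnW il) jl; rewrite -eij.
  by rewrite (path_mem_ends sp (ltnW il) il) eqxx !ltn_eqF // ltnW.
have e'_inj : injective e'.
  move=> i j; rewrite /e'; case: ltnP => [il|li]; case: ltnP => [jl|lj] eij.
  - apply: val_inj; case: (ltngtP i j) => // [/e_lt|/e_lt].
      by move/(_ jl); rewrite eij eqxx.
    by move/(_ il); rewrite eij eqxx.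
  - by have := de _ il; rewrite eij eqxx.
  - by have := de _ jl; rewrite eij eqxx.
  apply: val_inj => /=; apply/eqP; rewrite eqn_leq.
  by rewrite (leq_trans (ltn_ord i : i <= l) lj) (leq_trans (ltn_ord j : j <= l)).
have e'X i : e' i \in X by rewrite /e'; case: ltnP => // /vE[].
have l1_gt1 : 1 < l.+1 by [].
have incX i : incident X (v' i) = [set e' i; e' (ord_pred i)].
  have v'U : v' i \in U by apply: path_support sp _; rewrite -ltnS.
  apply: incident_pair; rewrite ?card_incident ?v'U // ?inE ?e'X ?eE.
  - by rewrite !inE eqxx.
  - by rewrite ord_predK !inE eqxx orbT.
  rewrite (inj_eq e'_inj); have := ordS_neq l1_gt1 (ord_pred i).
  by rewrite ord_predK.
have clos : closed (adj X) (codom v').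
  apply: (intro_closed (connect_adj_sym X)) => x y /adjP[b bX bE] /codomP[i xE].
  have: b \in incident X (v' i) by rewrite inE bX bE -xE !inE eqxx.
  have: y \in ends b by rewrite bE !inE eqxx orbT.
  by rewrite incX => yb /set2P[] bE'; move: yb; rewrite bE' eE => /set2P[]->;
    apply: codom_f.
have UE : U = [set x in codom v'].
  apply/setP=> x; rewrite inE; apply/idP/idP => [xU|/codomP[i ->]].
    rewrite -(closed_connect clos (connU (_ : v 0 \in U) xU)).
      exact: (codom_f v' ord0).
    by case: sp.
  by apply: path_support sp _; rewrite -ltnS.
have -> : #|U| = l.+1 by rewrite UE cardsE card_codom // card_ord.
split=> //; exists v', e'; split=> //; apply/setP=> b.
apply/idP/imsetP => [bX|[i _ ->]]; last exact: e'X.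
have /eqP/cards2P[x [y [_ bE]]] := card_ends b.
have xb : x \in ends b by rewrite bE !inE eqxx.
have := mem_support bX xb; rewrite UE inE => /codomP[i xE].
have: b \in incident X (v' i) by rewrite inE bX -xE.
by rewrite incX => /set2P[]->; [exists i | exists (ord_pred i)].
Qed.

(* A longest simple path closes up. *)
Lemma connected_2regular_is_cycle : is_cycle #|U| X.
Proof.
have e0 : edge G.
  by have := card_incident x0; rewrite x0U; case: (set_0Vmem (incident X x0)) =>
    [->|[e]]; rewrite ?cards0.
(* [k] bounds the extensions still possible, as a simple path of length [l] has [l.+1] distinct
   vertices. *)
suff main k l (v : nat -> vertex G) (e : nat -> edge G) :
    simple_path l v e -> #|vertex G| <= k + l -> is_cycle #|U| X.
  apply: (main #|vertex G| 0 (fun=> x0) (fun=> e0)); last by rewrite addn0.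
  by split=> // i j; rewrite /in_mem /= !leqn0 => /eqP-> /eqP->.
elim: k l v e => [|k IHk] l v e sp lek.
  have [_ v_inj _] := sp; exfalso.
  have v'_inj : injective (fun i : 'I_l.+1 => v i).
    by move=> i j /v_inj ij; apply/val_inj/ij; rewrite /in_mem /= -ltnS.
  by have := leq_card _ v'_inj; rewrite card_ord ltnNge lek.
have [d [dX vd de]] := next_edge sp; have [w wv dE] := ends_other vd.
have [_ v_inj vE] := sp.
have [/existsP[[t /= tl] /eqP wE]|/existsPn fresh] :=
    boolP [exists t : 'I_l.+1, w == v t]; last first.
  pose v' t := if t <= l then v t else w; pose e' t := if t < l then e t else d.
  have wP t : t <= l -> v t <> w.
    move=> tl vt; have := fresh (Ordinal (tl : t < l.+1)).
    by rewrite /= vt eqxx.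
  apply: (IHk l.+1 v' e'); last by rewrite addnS -addSn.
  split=> [|i j|t]; first by case: sp.
    rewrite /in_mem /= /v' => il jl.
    case: leqP => li; case: leqP => lj.
    - by move/v_inj; apply.
    - by move/(wP _ li).
    - by move/esym/(wP _ lj).
    - by move=> _; apply/eqP; rewrite eqn_leq (leq_trans il lj) (leq_trans jl li).
  rewrite ltnS leq_eqVlt /v' /e' => /orP[/eqP->|tl].
    by rewrite ltnn leqnn.
  by rewrite tl (ltnW tl); apply: vE.
(* The edge [d] returns to the path at [v t]. For [t = 0] it closes the path; for [0 < t < l] the
   edges [e t.-1], [e t] and [d] would be three at [v t]. *)
have {tl} lt_tl : t < l.
  rewrite ltn_neqAle -ltnS tl andbT; apply: contraNneq wv => tl'.
  by rewrite wE tl'.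
have [t0|t_gt0] := posnP t.
  by apply: (closed_path sp dX de); rewrite // -?t0 ?dE ?wE //; case: (t) lt_tl.
have lt_t1l : t.-1 < l by apply: leq_ltn_trans (leq_pred t) lt_tl.
have tU := path_support sp (ltnW lt_tl).
have: #|[set e t.-1; e t; d]| <= #|incident X (v t)|.
  apply: subset_leq_card; apply/subsetP=> b; rewrite !inE -orbA.
  case/or3P=> /eqP->; last by rewrite dX dE wE !inE eqxx orbT.
    by rewrite (path_mem_ends sp) ?(ltnW lt_tl) // prednK // eqxx orbT andbT;
      case: (vE _ lt_t1l).
  by rewrite (path_mem_ends sp) ?(ltnW lt_tl) // eqxx andbT; case: (vE _ lt_tl).
rewrite card_incident tU setUC cardsU1 cards2 !inE !negb_or !de //=.
suff -> : e t.-1 != e t by [].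
apply/eqP=> et; have := path_mem_ends sp (ltnW lt_t1l) lt_tl; rewrite -et.
rewrite (path_mem_ends sp (ltnW lt_t1l) lt_t1l) eqxx.
by rewrite !ltn_eqF // ?prednK // ltnS leq_pred.
Qed.

End Connected2Regular.

End EdgeSets.

(** * Matching the edges at two vertices by paths *)

Section Pairing.

Variables (G : multigraph) (u w : vertex G).
Implicit Types (X : {set edge G}) (x y z : vertex G) (a b e : edge G).
Hypotheses (neq_uw : u != w)
  (apart : forall e, ~~ ((u \in ends e) && (w \in ends e))).

(** Meant for edges at [u] or [w]: there [apart] leaves exactly one end outside the pair, and the
    default is not reached. *)
Definition far e : vertex G := odflt u [pick v in ends e :\: [set u; w]].

Lemma far_eq e z y : ends e = [set z; y] -> z \in [set u; w] ->
  y \notin [set u; w] -> far e = y.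
Proof.
move=> eE zuw yuw; rewrite /far; case: pickP => [x|/(_ y)] /=; rewrite !inE eE.
  by case/andP=> xuw /set2P[xz|->//]; move: zuw; rewrite !inE -xz (negPf xuw).
by move: yuw; rewrite !inE eqxx orbT => ->.
Qed.

Lemma ends_far e z : z \in ends e -> z \in [set u; w] ->
  ends e = [set z; far e] /\ far e \notin [set u; w].
Proof.
move=> ze zuw; have [y yz eE] := ends_other ze.
have yuw : y \notin [set u; w].
  apply: contra (apart e) => yuw; move: yz; rewrite eE.
  by case/set2P: zuw => ->; case/set2P: yuw => ->;
    rewrite ?eqxx ?set21 ?set22.
by rewrite (far_eq eE zuw yuw).
Qed.

Definition avoid X := [set e in X | (u \notin ends e) && (w \notin ends e)].

Lemma avoid_sub X : avoid X \subset X.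
Proof. by apply/subsetP=> e; rewrite inE => /andP[]. Qed.

Lemma connect_avoid X z t : t \in [set u; w] -> z \notin [set u; w] ->
  connect (adj (avoid X)) z t = false.
Proof.
move=> tuw zuw; apply: contraNF zuw; rewrite connect_adj_sym => ct.
suff <- : t = z by [].
case/connectP: ct => -[|y p] //= /andP[/adjP[e]].
rewrite inE => /andP[_ /andP[ue we]] eE; move: ue we.
by rewrite eE !inE !negb_or; case/set2P: tuw => ->; rewrite eqxx ?andbF.
Qed.

(** In a 2-regular [X], linked edges are those attached to the same path left by removing [u] and
    [w]. *)
Definition link X a b := connect (adj (avoid X)) (far a) (far b).

Lemma link_sym X a b : link X a b = link X b a.
Proof. exact: connect_adj_sym. Qed.

Lemma link_trans X : transitive (link X).
Proof. by move=> b a c; apply: connect_trans. Qed.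

(** This is [even_cut] for the component of [z] in [avoid X]: an edge of [X] leaves it exactly when
    it is an edge at [u] or [w] with its far end inside. *)
Lemma even_link X z : (forall v, ~~ odd #|incident X v|) ->
  z \notin [set u; w] ->
  ~~ odd #|[set e in incident X u :|: incident X w
              | connect (adj (avoid X)) z (far e)]|.
Proof.
move=> evX zuw; pose K := [set v | connect (adj (avoid X)) z v].
have := even_cut K evX.
suff -> : [set e in X | #|ends e :&: K| == 1] =
  [set e in incident X u :|: incident X w | connect (adj (avoid X)) z (far e)].
  by [].
apply/setP=> e; rewrite !inE -andb_orr -andbA; case eX: (e \in X) => //=.
have [|] := boolP (_ || _) => inc /=.
  have [t tuw te] : exists2 t, t \in [set u; w] & t \in ends e.
    by case/orP: inc => ?; [exists u | exists w]; rewrite ?set21 ?set22.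
  have [-> fuw] := ends_far te tuw; have tK : t \notin K.
    by rewrite inE connect_avoid.
  rewrite setIUl; have -> : [set t] :&: K = set0.
    by apply/eqP; rewrite setI_eq0 disjoints1.
  rewrite set0U; have [cf|cf] := boolP (connect _ z (far e)).
    by rewrite (setIidPl _) ?cards1 // sub1set inE.
  suff -> : [set far e] :&: K = set0 by rewrite cards0.
  by apply/eqP; rewrite setI_eq0 disjoints1 inE.
have eH : e \in avoid X by rewrite inE eX -negb_or.
have /eqP/cards2P[x [y [xy eE]]] := card_ends e.
have xyK : (x \in K) = (y \in K).
  rewrite !inE; apply: same_connect_r; first exact: connect_adj_sym.
  by apply/connect1/adjP; exists e.
rewrite eE setIUl; case xK: (x \in K).
  by rewrite !(setIidPl _) ?sub1set -?xyK // cards2 xy.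
suff /eqP-> : [set x] :&: K :|: [set y] :&: K == set0 by rewrite cards0.
by rewrite setU_eq0 !setI_eq0 !disjoints1 -xyK xK.
Qed.

(** * Links among two edges at each of the two vertices *)

Section TwoEdgesEach.

Variables (X : {set edge G}) (a1 a2 b1 b2 : edge G).
Hypotheses (evX : forall v, ~~ odd #|incident X v|)
  (neq_a : a1 != a2) (neq_b : b1 != b2)
  (incu : incident X u = [set a1; a2]) (incw : incident X w = [set b1; b2]).

Lemma incuP a : a \in [set a1; a2] -> a \in X /\ u \in ends a.
Proof. by rewrite -incu inE => /andP. Qed.

Lemma incwP b : b \in [set b1; b2] -> b \in X /\ w \in ends b.
Proof. by rewrite -incw inE => /andP. Qed.

Lemma far_u a : a \in [set a1; a2] ->
  ends a = [set u; far a] /\ far a \notin [set u; w].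
Proof. by case/incuP=> _ /ends_far; apply; rewrite set21. Qed.

Lemma far_w b : b \in [set b1; b2] ->
  ends b = [set w; far b] /\ far b \notin [set u; w].
Proof. by case/incwP=> _ /ends_far; apply; rewrite set22. Qed.

Lemma far_notin e : e \in [set a1; a2] :|: [set b1; b2] ->
  far e \notin [set u; w].
Proof. by case/setUP => [/far_u|/far_w] []. Qed.

Lemma even_link4 e : e \in [set a1; a2] :|: [set b1; b2] ->
  link X e a1 (+) link X e a2 (+) link X e b1 (+) link X e b2 = false.
Proof.
move=> eAB; have := even_link evX (far_notin eAB); rewrite incu incw => /negbTE <-.
rewrite cardsE -sum1_card big_mkcondr /=.
have disj : [disjoint [set a1; a2] & [set b1; b2]].
  rewrite disjoint_subset; apply/subsetP=> a /incuP[_ ua].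
  by rewrite inE; apply: contra (apart a) => /incwP[_ ->]; rewrite ua.
have sum2 (a b : edge G) (F : edge G -> nat) : a != b ->
    \sum_(i in [set a; b]) F i = F a + F b.
  by move=> ab; rewrite big_setU1 ?inE ?big_set1.
rewrite (eq_bigl [predU [set a1; a2] & [set b1; b2]]) => [|a]; last by rewrite !inE.
rewrite bigU //= !sum2 //.
by rewrite !oddD !(fun_if odd) /= /link; do 4!case: connect.
Qed.

Lemma link_connect a b : link X a b -> connect (adj X) (far a) (far b).
Proof. exact: connect_adjS (avoid_sub X) _ _. Qed.

Lemma connect_far e z : e \in X -> z \in ends e -> z \in [set u; w] ->
  connect (adj X) z (far e).
Proof.
move=> eX ze zuw; apply: (adj_edge eX ze).
by have [-> _] := ends_far ze zuw; rewrite set22.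
Qed.

Lemma connect_link a b : a \in [set a1; a2] -> b \in [set b1; b2] ->
  link X a b -> connect (adj X) u w.
Proof.
move=> /incuP[aX ua] /incwP[bX wb] /link_connect ab.
apply: connect_trans (connect_far aX ua (set21 _ _)) _.
apply: connect_trans ab _; rewrite connect_adj_sym.
by apply: connect_far; rewrite ?set22.
Qed.

(** A link between an edge at [u] and one at [w] would connect [u] to [w], so parity can only pair
    the edges at the same vertex. *)
Lemma link_disconnected : ~~ connect (adj X) u w -> link X a1 a2 && link X b1 b2.
Proof.
move=> nuw; have nab a b : a \in [set a1; a2] -> b \in [set b1; b2] ->
    link X a b = false.
  by move=> aA bB; apply: contraNF nuw; apply: connect_link.
have := even_link4 (e := a1); have := even_link4 (e := b1).
rewrite !inE !eqxx !orbT => /(_ isT) + /(_ isT).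
rewrite ![link X b1 a1]link_sym ![link X b1 a2]link_sym.
rewrite (nab a1 b1) ?(nab a1 b2) ?(nab a2 b1) ?set21 ?set22 //.
rewrite [link X a1 a1]connect0 [link X b1 b1]connect0.
by do 2!case: link.
Qed.

(** If [a1] were linked to no edge at [w], parity would link it to [a2], and [u] with their
    component would be closed under adjacency, cutting off [w]. Given a link from [a1] to [w],
    parity and transitivity yield one of the two matchings. *)
Lemma link_connected : connect (adj X) u w ->
  (link X a1 b1 && link X a2 b2) || (link X a1 b2 && link X a2 b1).
Proof.
move=> cuw; have la e : link X e e by exact: connect0.
have nab : link X a1 b1 || link X a1 b2.
  apply: contraTT cuw; rewrite negb_or => /andP[/negPf n1 /negPf n2].
  have fa : far a1 \notin [set u; w] by apply: far_notin; rewrite !inE eqxx.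
  pose K := [set v | (v == u) || connect (adj (avoid X)) (far a1) v].
  have la12 : link X a1 a2.
    have := even_link4 (e := a1); rewrite !inE eqxx => /(_ isT).
    by rewrite n1 n2 la !addbF => /negbFE.
  have clos : closed (adj X) K.
    apply: (intro_closed (connect_adj_sym X)) => x y /adjP[e eX eE] xK.
    have xe : x \in ends e by rewrite eE set21.
    have ye : y \in ends e by rewrite eE set22.
    have [ue|nue] := boolP (u \in ends e).
      have eA : e \in [set a1; a2] by rewrite -incu inE eX.
      have [eE' _] := far_u eA; move: ye; rewrite eE' !inE.
      case/orP=> /eqP->; rewrite ?eqxx //; apply/orP; right.
      by case/set2P: eA => -> //; apply: la.
    have [we|nwe] := boolP (w \in ends e); last first.
      move: xK; rewrite !inE => /orP[/eqP xu|cx]; first by rewrite -xu xe in nue.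
      rewrite (connect_trans cx) ?orbT //; apply/connect1/adjP.
      by exists e; rewrite // inE eX nue.
    have eB : e \in [set b1; b2] by rewrite -incw inE eX.
    have [eE' _] := far_w eB; move: xe xK; rewrite eE' !inE.
    case/orP=> /eqP->; first by rewrite eq_sym (negPf neq_uw) connect_avoid ?set22.
    case/orP=> [/eqP fu|]; first by rewrite eE' fu set22 in nue.
    by case/set2P: eB => ->; [rewrite -/(link X a1 b1) n1
                             | rewrite -/(link X a1 b2) n2].
  apply/negP=> /(closed_connect clos); rewrite !inE eqxx /= eq_sym (negPf neq_uw).
  by rewrite connect_avoid ?set22.
have := even_link4 (e := a1); have := even_link4 (e := a2).
rewrite !inE !eqxx !orbT => /(_ isT) + /(_ isT).
rewrite !la [link X a2 a1]link_sym => e2 e1.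
have tr b : (link X a1 a2 ==> link X a1 b ==> link X a2 b)
    && (link X a1 b ==> link X a2 b ==> link X a1 a2).
  apply/andP; split; apply/implyP=> l; apply/implyP.
    by apply: link_trans; rewrite link_sym.
  by move=> l'; apply: (link_trans l); rewrite link_sym.
move: (tr b1) (tr b2) e1 e2 nab; do 5!case: link => //=.
Qed.

(** The class trades [a1] for an edge at [w] and [b1] for one at [u], with the same far ends. If [u]
    and [w] were connected, the link of [a1] and [b1] joins them again; if not, the link of [a1] and
    [a2] now does. In both cases [u], [w] and the four far ends lie in one component, which makes up
    for the lost edges. *)
Lemma swap_connect X' a1' b1' :
  X :\: [set a1; b1] \subset X' -> a1' \in X' -> b1' \in X' ->
  ends a1' = [set w; far a1] -> ends b1' = [set u; far b1] ->
  (connect (adj X) u w -> link X a1 b1 && link X a2 b2) ->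
  subrel (connect (adj X)) (connect (adj X')) /\ connect (adj X') u w.
Proof.
move=> sXX' aX' bX' aE bE lab.
have [a1A b1B] : a1 \in [set a1; a2] /\ b1 \in [set b1; b2] by rewrite !set21.
have [a2A b2B] : a2 \in [set a1; a2] /\ b2 \in [set b1; b2] by rewrite !set22.
have sub a b : link X a b -> connect (adj X') (far a) (far b).
  apply: connect_adjS; apply: subset_trans sXX'; apply/subsetP=> e.
  rewrite !inE => /and3P[-> ue we]; rewrite andbT negb_or.
  apply/andP; split; [apply: contraNneq ue => -> | apply: contraNneq we => ->].
    by case/incuP: a1A.
  by case/incwP: b1B.
have wa : connect (adj X') w (far a1)
  by apply: (adj_edge aX'); rewrite aE !inE eqxx ?orbT.
have ub : connect (adj X') u (far b1)
  by apply: (adj_edge bX'); rewrite bE !inE eqxx ?orbT.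
have a2X' : a2 \in X'.
  apply: (subsetP sXX'); have [a2X ua] := incuP a2A; rewrite !inE a2X andbT.
  rewrite negb_or eq_sym neq_a; apply: contraNneq (apart a2) => a2b.
  by rewrite ua a2b; case/incwP: b1B.
have b2X' : b2 \in X'.
  apply: (subsetP sXX'); have [b2X wb] := incwP b2B; rewrite !inE b2X andbT.
  rewrite negb_or [b2 == b1]eq_sym neq_b andbT; apply: contraNneq (apart b2) => b2a.
  by rewrite wb b2a; case/incuP: a1A => _ ->.
have ua : connect (adj X') u (far a2).
  by apply: (adj_edge a2X'); have [-> _] := far_u a2A; rewrite !inE eqxx ?orbT.
have wb : connect (adj X') w (far b2).
  by apply: (adj_edge b2X'); have [-> _] := far_w b2B; rewrite !inE eqxx ?orbT.
have sym := connect_adj_sym X'.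
have [uw ua1] : connect (adj X') u w /\ connect (adj X') u (far a1).
  have [/lab/andP[/sub l1 _]|/link_disconnected/andP[/sub l1 /sub l2]] :=
    boolP (connect (adj X) u w).
    have ua1 : connect (adj X') u (far a1).
      by apply: connect_trans ub _; rewrite sym.
    by split=> //; apply: connect_trans ua1 _; rewrite sym.
  split; last by apply: connect_trans ua _; rewrite sym.
  by apply: connect_trans (connect_trans ub l2) _; rewrite sym.
have wb1 : connect (adj X') w (far b1).
  by apply: connect_trans ub; rewrite sym.
split=> //; apply: connect_sub => x y /adjP[e eX eE].
have [ea|nea] := eqVneq e a1.
  have [a1E _] := far_u a1A; have := set21 x y; have := set22 x y.
  rewrite -eE ea a1E => /set2P[]-> /set2P[]-> //; by rewrite sym.
have [eb|neb] := eqVneq e b1.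
  have [b1E _] := far_w b1B; have := set21 x y; have := set22 x y.
  rewrite -eE eb b1E => /set2P[]-> /set2P[]-> //; by rewrite sym.
apply/connect1/adjP; exists e => //; apply: (subsetP sXX').
by rewrite !inE eX negb_or nea neb.
Qed.

End TwoEdgesEach.

End Pairing.

(** * Exchanging colours at two twin vertices *)

Section Exchange.

Variables (G : multigraph) (I : finType) (u w : vertex G).
Variable pi : edge G -> edge G.
Implicit Types (c : option I) (f : edge G -> option I) (v : vertex G).
Hypotheses (neq_uw : u != w)
  (apart : forall e : edge G, ~~ ((u \in ends e) && (w \in ends e)))
  (piK : involutive pi)
  (ends_pi : forall e, ends (pi e) = [set tperm u w v | v in ends e]).

Definition color_class f c := [set e | f e == c].

Definition potential f :=
  \sum_i #|[set p | connect (adj (color_class f (Some i))) p.1 p.2]|.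

Lemma mem_ends_pi e v : (v \in ends (pi e)) = (tperm u w v \in ends e).
Proof. by rewrite ends_pi -{1}(tpermK u w v) mem_imset //; apply: perm_inj. Qed.

Lemma mem_pi_u e : (u \in ends (pi e)) = (w \in ends e).
Proof. by rewrite mem_ends_pi tpermL. Qed.

Lemma mem_pi_w e : (w \in ends (pi e)) = (u \in ends e).
Proof. by rewrite mem_ends_pi tpermR. Qed.

Lemma ends_pi_u e : u \in ends e ->
  ends (pi e) = [set w; far u w e] /\ far u w (pi e) = far u w e.
Proof.
move=> ue; have [eE] := ends_far apart ue (set21 _ _).
rewrite !inE negb_or => /andP[fu fw].
have pE : ends (pi e) = [set w; far u w e].
  by rewrite ends_pi eE imsetU1 imset_set1 tpermL tpermD 1?eq_sym.
by split=> //; apply: far_eq pE _ _; rewrite ?set22 // !inE negb_or fu.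
Qed.

Variable f : edge G -> option I.
Hypotheses
  (deg02 : forall i v, exists b : bool,
     #|incident (color_class f (Some i)) v| = 2 * b)
  (deg_uw : forall c,
     #|incident (color_class f c) u| = #|incident (color_class f c) w|).

Let even_class i v : ~~ odd #|incident (color_class f (Some i)) v|.
Proof. by have [b ->] := deg02 i v; rewrite oddM. Qed.

(** As the colour degrees at [u] and [w] agree, some bijection exists, and any one serves for [None]
    and for colours separating [u] from [w]. In the other colours [link_connected] provides one
    along the links. *)
Lemma color_pairing c : exists h : edge G -> edge G,
  [/\ {in incident (color_class f c) w &, injective h},
      {in incident (color_class f c) w,
        forall b, h b \in incident (color_class f c) u}
    & c != None -> connect (adj (color_class f c)) u w ->
      {in incident (color_class f c) w,
        forall b, link u w (color_class f c) b (h b)}].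
Proof.
set X := color_class f c.
have default : exists h : edge G -> edge G,
    {in incident X w &, injective h} /\
    {in incident X w, forall b, h b \in incident X u}.
  (* Edges are matched by rank in the two enumerations; equal degrees keep the default [b] out of
     reach. *)
  exists (fun b => nth b (enum (incident X u)) (index b (enum (incident X w)))).
  have idx b : b \in incident X w ->
      index b (enum (incident X w)) < size (enum (incident X u)).
    by move=> bX; rewrite -cardE deg_uw cardE index_mem mem_enum.
  split=> [b b' bX b'X|b bX]; last by rewrite -mem_enum mem_nth ?idx.
  rewrite (set_nth_default b) ?idx // => /eqP.
  rewrite nth_uniq ?idx ?enum_uniq // => /eqP bb'.
  by rewrite -[b](nth_index b (s := enum (incident X w))) ?mem_enum // bb'
    nth_index ?mem_enum.
case: c @X default => [i|] X default; last by have [h [? ?]] := default; exists h.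
have [cuw|ncuw] := boolP (connect (adj X) u w); last first.
  by have [h [? ?]] := default; exists h; split.
have [[]] := deg02 i u; rewrite -/X /= ?muln0 ?muln1 => cu; last first.
  exists id; have -> : incident X w = set0 by apply: cards0_eq; rewrite -deg_uw.
  by split=> [b b'|b|_ _ b]; rewrite inE.
have cw : #|incident X w| = 2 by rewrite -deg_uw.
have /eqP/cards2P[a1 [a2 [na incu]]] := cu.
have /eqP/cards2P[b1 [b2 [nb incw]]] := cw.
suff [x [y [[xA yA] xy l1 l2]]] : exists x y,
    [/\ x \in [set a1; a2] /\ y \in [set a1; a2], x != y, link u w X b1 x
      & link u w X b2 y].
  exists (fun b => if b == b1 then x else y); rewrite incu incw.
  have yx : y == x = false by rewrite eq_sym (negPf xy).
  have b21 : b2 == b1 = false by rewrite eq_sym (negPf nb).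
  split=> [b b'|b|_ _ b]; last 2 first.
  - by move=> _; case: ifP.
  - by case/set2P=> ->; rewrite ?eqxx ?b21.
  case/set2P=> -> /set2P[]->; rewrite ?eqxx ?b21 // => /eqP.
    by rewrite (negPf xy).
  by rewrite yx.
have := link_connected neq_uw apart (even_class i) na nb incu incw cuw.
case/orP=> /andP[]; rewrite [link u w _ a1 _]link_sym [link u w _ a2 _]link_sym.
  by exists a1, a2; rewrite !inE !eqxx orbT.
by exists a2, a1; rewrite set21 set22 [a2 == a1]eq_sym.
Qed.

(* [s e] is the edge at [u] that takes over the colour of [pi e] when the
   colours of [e] and [pi e] are exchanged. *)
Definition is_twist (s : {perm edge G}) :=
  [/\ forall e, (u \in ends (s e)) = (u \in ends e),
      forall e, u \in ends e -> f (s e) = f (pi e)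
    & forall i e, u \in ends e -> f (pi e) = Some i ->
        connect (adj (color_class f (Some i))) u w ->
        link u w (color_class f (Some i)) e (s e)].

(** An edge [e] at [u] is sent to the partner of [pi e]. Since [s e] has the colour of [pi e], equal
    images come from a single colour, in which the pairing is injective. *)
Lemma twist_exists : exists s, is_twist s.
Proof.
have [h hP] := fin_all_exists color_pairing.
pose s e := if u \in ends e then h (f (pi e)) (pi e) else e.
have incP e : u \in ends e ->
    pi e \in incident (color_class f (f (pi e))) w.
  by move=> ue; rewrite !inE eqxx mem_pi_w.
have sP e : u \in ends e -> u \in ends (s e) /\ f (s e) = f (pi e).
  move=> ue; rewrite /s ue; have [_ /(_ _ (incP e ue)) + _] := hP (f (pi e)).
  by rewrite !inE => /andP[/eqP].
have su e : (u \in ends (s e)) = (u \in ends e).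
  by case: (boolP (u \in ends e)) => [/sP[]//|ue]; rewrite /s !(negPf ue).
have s_inj : injective s.
  move=> e e' see'; have := su e; rewrite see' su => uee'; move: see'.
  case: (boolP (u \in ends e)) => ue; last by rewrite /s uee' (negPf ue).
  have ue' : u \in ends e' by rewrite uee'.
  move=> see'; have [_ fe] := sP e ue; have [_ fe'] := sP e' ue'.
  have pp : f (pi e) = f (pi e') by rewrite -fe -fe' see'.
  move: see'; rewrite /s ue ue' pp => hh; apply: (can_inj piK).
  have [h_inj _ _] := hP (f (pi e')); apply: h_inj => //; last exact: incP.
  by rewrite -pp incP.
exists (perm s_inj); split=> [e|e ue|i e ue fe cuw]; rewrite permE //.
  by case: (sP e ue).
have [_ _ /(_ isT)] := hP (Some i).
move=> /(_ cuw (pi e)); rewrite -{1}fe => /(_ (incP e ue)).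
by rewrite /link (ends_pi_u ue).2 /s ue fe.
Qed.

(* Composing with the transposition of [a1] and [a2] splits their common cycle. *)
Lemma twist_separates i a1 a2 :
  a1 \in incident (color_class f (Some i)) u ->
  a2 \in incident (color_class f (Some i)) u -> a1 != a2 ->
  ~~ connect (adj (color_class f (Some i))) u w ->
  exists2 s, is_twist s & a2 \notin porbit s a1.
Proof.
rewrite !inE => /andP[/eqP fa1 ua1] /andP[/eqP fa2 ua2] na ncuw.
have [s [su sf sl]] := twist_exists.
have [same|] := boolP (a2 \in porbit s a1); last by exists s.
pose t := tperm a1 a2; exists (s * t)%g.
  have tE e : u \in ends e -> u \in ends (t e) /\ f (t e) = f e.
    by rewrite /t; case: tpermP => [->|->|] //; rewrite ?fa1 ?fa2.
  split=> [e|e ue|i' e ue fe cuw]; rewrite permM.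
  - case: (boolP (u \in ends e)) => ue; first by have [] := tE (s e); rewrite ?su.
    have nus : u \notin ends (s e) by rewrite su.
    by rewrite tpermD ?(negPf nus) //; apply: contraNneq nus => <-.
  - by have [|_ ->] := tE (s e); rewrite ?su // sf.
  have fse := sf e ue; rewrite fe in fse.
  (* Here [s e] has a colour connecting [u] and [w], unlike the colour [i] of [a1] and [a2]; so [t]
     does not disturb the links. *)
  have ni a : f a = Some i -> a != s e.
    by move=> fa; apply: contraNneq ncuw => ae; move: cuw; rewrite -fse -ae fa.
  by rewrite tpermD ?ni //; apply: sl.
(* Multiplying [s^-1] by [t] adds a cycle, as [a1] and [a2] share one. If they still shared one in
   [t * s^-1], the inverse of [s * t], multiplying again would add another, yet it gives back
   [s^-1]. *)
have := porbits_mul_tperm s^-1 a1 a2; rewrite /= -/t na porbitV porbit_sym same.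
have := porbits_mul_tperm (t * s^-1) a1 a2.
rewrite /= -/t mulgA tperm2 mul1g na -[t in porbit (t * _)]tpermV -invMg porbitV.
rewrite porbit_sym; case: (a2 \in _) => //=; rewrite !addn0 => + e.
by rewrite e -addnA -{1}[#|_|]addn0 => /addnI.
Qed.

(** * Exchanging colours along a set of edges stable under a twist *)

Section Swap.

Variables (s : {perm edge G}) (S : {set edge G}).
Hypotheses (twist_s : is_twist s) (S_u : forall e, e \in S -> u \in ends e)
  (S_s : forall e, (s e \in S) = (e \in S)).

Definition swap e := if (e \in S) || (pi e \in S) then pi e else e.

Lemma swapK : involutive swap.
Proof.
move=> e; rewrite /swap; case swe: ((e \in S) || (pi e \in S)); last by rewrite swe.
by rewrite piK orbC swe.
Qed.

Let S_pi_w e : pi e \in S -> w \in ends e.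
Proof. by move/S_u; rewrite mem_pi_u. Qed.

Let S_pi_u e : pi e \in S -> u \notin ends e.
Proof. by move/S_pi_w=> we; have := apart e; rewrite we andbT. Qed.

Let card_incident_reindex psi v c : injective psi ->
  (forall e, (v \in ends (psi e)) = (v \in ends e)) ->
  (forall e, v \in ends e -> f (swap e) = f (psi e)) ->
  #|incident (color_class (f \o swap) c) v| = #|incident (color_class f c) v|.
Proof.
move=> psi_inj psi_v psi_f; rewrite -[RHS](card_preimset _ psi_inj).
apply: eq_card => e; rewrite !inE /= psi_v.
by case: (boolP (v \in ends e)) => [/psi_f->|]; rewrite ?andbF.
Qed.

(** At each vertex the new colours are the old ones permuted: at [u] by [s] on [S], as [s e] and
    [pi e] have the same colour; at [w] by the conjugate of [s^-1] under [pi]; elsewhere by [swap],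
    which preserves incidence there. *)
Lemma card_incident_swap c v :
  #|incident (color_class (f \o swap) c) v| = #|incident (color_class f c) v|.
Proof.
have [su sf _] := twist_s.
have S_s' e : (s^-1%g e \in S) = (e \in S) by rewrite -S_s permKV.
have su' e : (u \in ends (s^-1%g e)) = (u \in ends e) by rewrite -su permKV.
have [->|vu] := eqVneq v u.
  apply: (@card_incident_reindex (fun e => if e \in S then s e else e)).
  - move=> e e'; case: ifP => eS; case: ifP => e'S ee' //; first exact: perm_inj ee'.
      by move: e'S; rewrite -ee' S_s eS.
    by move: eS; rewrite ee' S_s e'S.
  - by move=> e; case: ifP.
  move=> e ue; rewrite /swap; case: ifP => /= [/orP[eS|/S_pi_u]|]; last 2 first.
  - by rewrite ue.
  - by move/norP=> [/negPf->].
  by rewrite eS sf.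
have [->|vw] := eqVneq v w.
  apply: (@card_incident_reindex
    (fun e => if pi e \in S then pi (s^-1%g (pi e)) else e)).
  - move=> e e'; case: ifP => eS; case: ifP => e'S ee' //.
    + by apply: (can_inj piK); apply: perm_inj (can_inj piK ee').
    + by move: e'S; rewrite -ee' piK S_s' eS.
    by move: eS; rewrite ee' piK S_s' e'S.
  - by move=> e; case: ifP => // _; rewrite mem_pi_w su' mem_pi_u.
  move=> e we; rewrite /swap; case: (boolP (pi e \in S)) => peS.
    have upe : u \in ends (s^-1%g (pi e)) by rewrite su' mem_pi_u.
    by rewrite orbT -[RHS]sf // permKV.
  case: (boolP (e \in S)) => //= /S_u ue.
  by have := apart e; rewrite ue we.
apply: (@card_incident_reindex swap) => [|e|//]; first exact: can_inj swapK.
by rewrite /swap; case: ifP => // _; rewrite mem_ends_pi tpermD // eq_sym.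
Qed.

Let swap_class i e : e \in color_class f (Some i) ->
  swap e \in color_class (f \o swap) (Some i).
Proof. by rewrite !inE /= swapK. Qed.

(** With [s e1 = a1], the class of colour [i] trades [a1] for [pi a1] and [pi e1] for [e1], the
    situation of [swap_connect]. The links it demands when [u] and [w] are connected come from
    [is_twist]. *)
Lemma swap_split i a1 a2 (X := color_class f (Some i))
    (X' := color_class (f \o swap) (Some i)) :
  a1 \in incident X u -> a2 \in incident X u -> a1 \in S -> a2 \notin S ->
  subrel (connect (adj X)) (connect (adj X')) /\ connect (adj X') u w.
Proof.
move=> a1X a2X a1S a2S; have [su sf sl] := twist_s.
pose e1 := s^-1%g a1; pose e2 := s^-1%g a2.
have se1 : s e1 = a1 by rewrite permKV.
have se2 : s e2 = a2 by rewrite permKV.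
have e1S : e1 \in S by rewrite -S_s se1.
have e2S : e2 \notin S by rewrite -S_s se2.
have na : a1 != a2 by apply: contraNneq a2S => <-.
have nb : pi e1 != pi e2.
  by rewrite (can_eq piK); apply: contraNneq e2S => <-.
have cu : #|incident X u| = 2.
  have [[] //] := deg02 i u; rewrite muln0 => /cards0_eq X0.
  by move: a1X; rewrite /X X0 inE.
have cw : #|incident X w| = 2 by rewrite -deg_uw.
have incu := incident_pair cu a1X a2X na.
have [/andP[/eqP fa1 ua1] /andP[/eqP fa2 ua2]] :
    (f a1 == Some i) && (u \in ends a1) /\ (f a2 == Some i) && (u \in ends a2).
  by move: a1X a2X; rewrite !inE.
have ue1 : u \in ends e1 by rewrite -su se1.
have ue2 : u \in ends e2 by rewrite -su se2.
have fb1 : f (pi e1) = Some i by rewrite -sf ?se1.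
have fb2 : f (pi e2) = Some i by rewrite -sf ?se2.
have b1X : pi e1 \in incident X w by rewrite !inE fb1 eqxx mem_pi_w.
have b2X : pi e2 \in incident X w by rewrite !inE fb2 eqxx mem_pi_w.
have incw := incident_pair cw b1X b2X nb.
apply: (swap_connect apart (even_class i) na nb incu incw (a1' := pi a1) (b1' := e1)).
- apply/subsetP=> e; rewrite in_setD => /andP[nab eX].
  suff -> : e = swap e by apply: swap_class.
  rewrite /swap; case: ifP => // /orP[eS|peS].
    have : e \in incident X u by rewrite inE eX S_u.
    rewrite incu => /set2P[] eE; first by rewrite eE !inE eqxx in nab.
    by rewrite -eE eS in a2S.
  have : e \in incident X w by rewrite inE eX S_pi_w.
  rewrite incw => /set2P[] eE; first by rewrite eE !inE eqxx orbT in nab.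
  by rewrite eE piK (negPf e2S) in peS.
- suff -> : pi a1 = swap a1 by apply: swap_class; rewrite inE fa1.
  by rewrite /swap a1S.
- suff {1}-> : e1 = swap (pi e1) by apply: swap_class; rewrite inE fb1.
  by rewrite /swap piK e1S orbT.
- by case: (ends_pi_u ua1).
- rewrite (ends_pi_u ue1).2; by case: (ends_far apart ue1 (set21 _ _)).
move=> cuw; rewrite [link _ _ _ a1 _]link_sym [link _ _ _ a2 _]link_sym.
rewrite /link (ends_pi_u ue1).2 (ends_pi_u ue2).2 -{1}se1 -{1}se2.
by rewrite -!/(link u w X _ _) !sl.
Qed.

(** If [S] contains no edge of the colour at [u], the class loses nothing; if it contains some but
    not all, [swap_split] applies. If it contains all of them, the class is moved as a whole by the
    transposition of [u] and [w], which is then taken as [g]. *)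
Lemma swap_monotone i (X := color_class f (Some i))
    (X' := color_class (f \o swap) (Some i)) :
  exists2 g : vertex G -> vertex G, injective g &
    forall x y, connect (adj X) x y -> connect (adj X') (g x) (g y).
Proof.
have [su sf _] := twist_s.
have spX e : e \in X -> w \in ends e -> s (pi e) \in incident X u.
  by rewrite !inE => /eqP fe we; rewrite su sf mem_pi_u // piK fe eqxx.
have [/exists_inP[a1 a1X a1S]|/exists_inPn noS] :=
    boolP [exists a in incident X u, a \in S]; last first.
  exists id => //; apply: connect_adjS; apply/subsetP=> e eX.
  suff -> : e = swap e by apply: swap_class.
  rewrite /swap; case: ifP => // /orP[eS|peS].
    by have := noS e; rewrite eS inE eX S_u // => /(_ isT).
  by have := noS _ (spX e eX (S_pi_w peS)); rewrite S_s peS.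
have [/exists_inP[a2 a2X a2S]|/exists_inPn allS] :=
    boolP [exists a in incident X u, a \notin S].
  by exists id => //; have [] := swap_split a1X a2X a1S a2S.
exists (tperm u w); first exact: perm_inj.
have ends_swap e : e \in X -> ends (swap e) = [set tperm u w v | v in ends e].
  move=> eX; rewrite /swap; case: ifP => [_|/norP[eS peS]]; first exact: ends_pi.
  have ue : u \notin ends e.
    by apply: contra eS => ue; apply/negbNE/allS; rewrite inE eX.
  have we : w \notin ends e.
    by apply: contra peS => we; rewrite -S_s; apply/negbNE/allS/spX.
  rewrite -[LHS]imset_id; apply: eq_in_imset => v ve.
  by rewrite tpermD //; apply: contraTneq ve => <-.
move=> x y /connectP[p]; elim: p x => [|z p IHp] x /=.
  by move=> _ ->; apply: connect0.
case/andP=> /adjP[e eX eE] zp /IHp -/(_ zp); apply: connect_trans.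
apply/connect1/adjP; exists (swap e); first exact: swap_class.
by rewrite ends_swap // eE imsetU1 imset_set1.
Qed.

(** Colour [i] gains the pair [(u, w)], and by [swap_monotone] the count of no other colour
    drops. *)
Lemma potential_swap i a1 a2 :
  a1 \in incident (color_class f (Some i)) u ->
  a2 \in incident (color_class f (Some i)) u -> a1 \in S -> a2 \notin S ->
  ~~ connect (adj (color_class f (Some i))) u w ->
  potential f < potential (f \o swap).
Proof.
move=> a1X a2X a1S a2S ncuw; rewrite /potential (bigD1 i) // [ltnRHS](bigD1 i) //=.
rewrite -addSn leq_add //.
  have [sub cuw] := swap_split a1X a2X a1S a2S; apply: proper_card.
  apply/properP; split; first by apply/subsetP=> p; rewrite !inE; apply: sub.
  by exists (u, w); rewrite inE.
apply: leq_sum => j _; have [g g_inj gP] := swap_monotone j.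
have gg_inj : injective (fun p => (g p.1, g p.2)).
  by move=> [x y] [x' y'] [/g_inj-> /g_inj->].
rewrite -(card_imset _ gg_inj); apply/subset_leq_card/subsetP=> q.
by case/imsetP=> p; rewrite inE => cp ->; rewrite inE; apply: gP.
Qed.

End Swap.

Lemma exchange i : #|incident (color_class f (Some i)) u| = 2 ->
  ~~ connect (adj (color_class f (Some i))) u w ->
  exists th : edge G -> edge G,
  [/\ involutive th, forall e, th e = e \/ th e = pi e,
      forall c v, #|incident (color_class (f \o th) c) v|
        = #|incident (color_class f c) v|
    & potential f < potential (f \o th)].
Proof.
move=> card2 ncuw; have /eqP/cards2P[a1 [a2 [na incu]]] := card2.
have a1X : a1 \in incident (color_class f (Some i)) u by rewrite incu set21.
have a2X : a2 \in incident (color_class f (Some i)) u by rewrite incu set22.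
have [s twist_s a2S] := twist_separates a1X a2X na ncuw.
have [su _ _] := twist_s; pose S := porbit s a1.
have S_s e : (s e \in S) = (e \in S).
  by have := porbit_perm s 1 e; rewrite expg1 -!eq_porbit_mem => ->.
have S_u e : e \in S -> u \in ends e.
  case/porbitP=> n ->; elim: n => [|n IHn]; last by rewrite expgSr permM su.
  by rewrite expg0 perm1; move: a1X; rewrite inE => /andP[].
exists (swap S); split.
- exact: swapK.
- by move=> e; rewrite /swap; case: ifP => _; [right | left].
- exact: card_incident_swap twist_s S_u S_s.
exact: (potential_swap twist_s S_u S_s a1X a2X (porbit_id _ _) a2S).
Qed.

End Exchange.

(** * Spreading a decomposition over the fibres *)

Section Spread.

Variables (G G0 : multigraph) (m : nat).
Variables (p : vertex G -> vertex G0) (g : edge G -> edge G0).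
Hypotheses (m_gt0 : 0 < m)
  (card_fibre : forall x, #|[set v | p v == x]| = m)
  (ends_g : forall e, ends (g e) = [set p v | v in ends e])
  (g_inj : forall v e e', v \in ends e -> v \in ends e' -> g e = g e' -> e = e')
  (g_lift : forall v e0, p v \in ends e0 -> exists2 e, v \in ends e & g e = e0)
  (twins : forall u w, u != w -> p u = p w -> exists2 pi : edge G -> edge G,
     involutive pi & forall e, ends (pi e) = [set tperm u w v | v in ends e]).

(** The projection of an edge inside a fibre would have a single end. *)
Lemma fibre_apart u w e : u != w -> p u = p w ->
  ~~ ((u \in ends e) && (w \in ends e)).
Proof.
move=> uw puw; apply/negP=> /andP[ue we].
have eE : ends e = [set u; w].
  apply/eqP; rewrite eq_sym eqEcard card_ends cards2 uw andbT.
  by apply/subsetP=> x /set2P[]->.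
by have := card_ends (g e); rewrite ends_g eE imsetU1 imset_set1 puw setUid cards1.
Qed.

(** By [g_inj] and [g_lift], as for a covering of graphs, [g] maps the edges at [v] bijectively onto
    those at [p v]. *)
Lemma card_incident_lift (I : finType) (f0 : edge G0 -> option I) c v :
  #|incident (color_class (f0 \o g) c) v| = #|incident (color_class f0 c) (p v)|.
Proof.
rewrite -(@card_in_imset _ _ g); last first.
  by move=> e e'; rewrite !inE => /andP[_ ve] /andP[_ ve']; apply: (g_inj ve ve').
apply: eq_card => e0; rewrite !inE; apply/imsetP/andP => [[e]|[fe0 ve0]].
  rewrite !inE /= => /andP[fe ve] ->; split=> //.
  by rewrite ends_g imset_f.
have [e ve ge] := g_lift ve0.
by exists e; rewrite // !inE /= ge fe0.
Qed.

Lemma card_preim_fibre (U : {set vertex G0}) : #|[set v | p v \in U]| = #|U| * m.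
Proof.
rewrite -sum_nat_const -sum1_card (partition_big p (mem U)) /=; last first.
  by move=> v; rewrite inE.
apply: eq_bigr => x xU; rewrite -(card_fibre x) -sum1_card; apply: eq_bigl => v.
by rewrite !inE andb_idl // => /eqP->.
Qed.

(** * Lifted colourings and the connectivity of their classes *)

Section Coloring.

Variables (I : finType) (f0 : edge G0 -> option I) (U : I -> {set vertex G0}).
Hypotheses
  (card_base : forall i x,
     #|incident (color_class f0 (Some i)) x| = 2 * (x \in U i))
  (conn_base : forall i,
     {in U i &, forall x y, connect (adj (color_class f0 (Some i))) x y}).

(** The invariant kept by exchanges. Its second clause lets paths of a base colour be lifted edge by
    edge. *)
Definition spread_coloring (f : edge G -> option I) :=
  (forall c v,
     #|incident (color_class f c) v| = #|incident (color_class f0 c) (p v)|) /\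
  (forall e0, exists2 e, f e = f0 e0 & [set p v | v in ends e] = ends e0).

Lemma spread_lift : spread_coloring (f0 \o g).
Proof.
split=> [c v|e0]; first exact: card_incident_lift.
have /eqP/cards2P[x [y [_ e0E]]] := card_ends e0.
have xe0 : x \in ends e0 by rewrite e0E set21.
have /set0Pn[v] : [set v | p v == x] != set0 by rewrite -card_gt0 card_fibre.
rewrite inE => /eqP vx; rewrite -vx in xe0.
by have [e _ ge] := g_lift xe0; exists e; rewrite /= -?ends_g ge.
Qed.

(** Lifts of consecutive edges of a base path need not share a vertex, but they have ends in a
    common fibre, which the hypothesis on fibres connects. *)
Lemma spread_connected f i :
  spread_coloring f ->
  (forall u w, p u = p w -> p u \in U i ->
     connect (adj (color_class f (Some i))) u w) ->
  {in [set v | p v \in U i] &,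
     forall v w, connect (adj (color_class f (Some i))) v w}.
Proof.
move=> [_ fe] fib v w; rewrite !inE => vU wU.
have /connectP[q] := conn_base vU wU.
elim: q v vU => [|z q IHq] v vU /=; first by move=> _ wv; apply: fib; rewrite ?wv.
case/andP=> /adjP[e0]; rewrite inE => /eqP fe0 e0E zq wq.
have [e fe_i eE] := fe e0; rewrite e0E in eE; rewrite fe0 in fe_i.
have /imsetP[v' v'e v'E] : p v \in [set p v | v in ends e] by rewrite eE set21.
have /imsetP[z' z'e z'E] : z \in [set p v | v in ends e] by rewrite eE set22.
have z'U : p z' \in U i.
  rewrite -z'E; have := card_base i z; case: (z \in U i) => // /eqP.
  by rewrite muln0 cards_eq0 => /eqP/setP/(_ e0); rewrite !inE fe0 e0E set22 eqxx.
apply: connect_trans (fib _ _ v'E vU) _.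
apply: connect_trans (adj_edge _ v'e z'e) _; first by rewrite inE fe_i.
by apply: IHq => //; rewrite -z'E.
Qed.

Lemma connected_spread_coloring : exists2 f, spread_coloring f & forall i,
  {in [set v | p v \in U i] &,
     forall v w, connect (adj (color_class f (Some i))) v w}.
Proof.
pose N := \sum_(i : I) #|{: vertex G * vertex G}|.
have potN (f : edge G -> option I) : potential f <= N.
  by apply: leq_sum => i _; apply: max_card.
(* [k] bounds the exchanges still possible: each one raises the potential, which stays at most
   [N]. *)
suff main k f : spread_coloring f -> N <= k + potential f ->
    exists2 f, spread_coloring f & forall i, {in [set v | p v \in U i] &,
      forall v w, connect (adj (color_class f (Some i))) v w}.
  by apply: (main N (f0 \o g)); [apply: spread_lift | apply: leq_addr].
elim: k f => [|k IHk] f sf Nk; have [f_card f_edge] := sf;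
  have [/forallP conn|] := boolP [forall i, forall u, forall w,
    (p u == p w) && (p u \in U i) ==> connect (adj (color_class f (Some i))) u w].
(* Goals 1 and 3 are the connected cases, for [k = 0] and for the successor; the others exchange
   colours at a disconnected pair in one fibre. *)
1,3: exists f => // i; apply: spread_connected => // u w puw uU;
  by have /forallP/(_ u)/forallP/(_ w) := conn i; rewrite puw eqxx -puw uU.
all: case/forallPn=> i /forallPn[u /forallPn[w]].
all: rewrite negb_imply => /andP[/andP[/eqP puw uU] ncuw].
all: have uw : u != w by apply: contraNneq ncuw => ->.
all: have [pi piK ends_pi] := twins uw puw.
all: have := exchange uw (fun e => fibre_apart e uw puw) piK ends_pi (f := f).
all: case/(_ _ _ i) => [j v|c|||th [thK th_pi th_card pot]] //;
  try by rewrite !f_card ?puw.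
all: try by rewrite f_card card_base; exists (p v \in U j).
all: try by rewrite f_card card_base uU.
  by have := leq_trans pot (potN _); rewrite ltnNge Nk.
apply: (IHk (f \o th)); last first.
  by rewrite (leq_trans Nk) // addSnnS leq_add2l.
split=> [c v|e0]; first by rewrite th_card.
(* After the exchange [th e] has the old colour of [e], and its ends have the same projection
   because [tperm u w] preserves fibres. *)
have [e fe eE] := f_edge e0; exists (th e); first by rewrite /= thK.
case: (th_pi e) => -> //; rewrite ends_pi -imset_comp -eE.
by apply: eq_imset => v /=; case: tpermP => // ->.
Qed.

End Coloring.

Lemma on_cycle_incident (H : multigraph) (v : vertex H) (X : {set edge H}) :
  on_cycle v X = (0 < #|incident X v|).
Proof.
rewrite card_gt0; apply/exists_inP/set0Pn => -[e].
  by move=> eX ve; exists e; rewrite inE eX.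
by rewrite inE => /andP[]; exists e.
Qed.

(** Each connected lifted class is a cycle through the whole preimage of [U i], which has [c i * m]
    vertices. It passes through [v] exactly when the base cycle passes through [p v], so the same
    partition [P] of the indices resolves it. *)
Lemma spread_resolvable_cycle_decomposition alpha k (c : 'I_k -> nat) :
  admits_resolvable_cycle_decomposition G0 alpha c ->
  admits_resolvable_cycle_decomposition G alpha (fun i => c i * m).
Proof.
case=> C [[C_cycle [F [FE count]]] [P [partP resP]]].
(* By [count] each edge lies either in exactly one cycle or in [F], so the choice is forced and
   [None] marks [F]. *)
pose f0 e := [pick i | e \in C i].
have CE i : color_class f0 (Some i) = C i.
  apply/setP=> e; rewrite inE /f0; case: pickP => [j eCj|->] //.
  apply/eqP/idP => [[<-] //|eCi]; congr Some.
  have /eqP/cards1P[i1 setE] : #|[set i | e \in C i]| = 1.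
    apply/eqP; rewrite eqn_leq -[X in _ <= X](count e) leq_addr card_gt0.
    by apply/set0Pn; exists i; rewrite inE.
  have /setP setE' := setE; have := setE' i; have := setE' j.
  by rewrite !inE eCi eCj => /esym/eqP-> /esym/eqP->.
have FE' : color_class f0 None = F.
  apply/setP=> e; rewrite inE /f0; have := count e.
  case: pickP => [j eCj|noC].
    have : 0 < #|[set i | e \in C i]|.
      by rewrite card_gt0; apply/set0Pn; exists j; rewrite inE.
    by case: #|_| => //= q _; case: (e \in F) => //; rewrite addn1.
  rewrite (_ : [set i | e \in C i] = set0) ?cards0 ?add0n.
    by case: (e \in F).
  by apply/setP=> i; rewrite !inE noC.
pose U i := [set x | on_cycle x (C i)].
have [card_base conn_base card_U c_gt1] : [/\ forall i x,
     #|incident (color_class f0 (Some i)) x| = 2 * (x \in U i),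
   forall i, {in U i &, forall x y,
     connect (adj (color_class f0 (Some i))) x y},
   forall i, #|U i| = c i & forall i, 1 < c i].
  have UP i : exists2 v : 'I_(c i) -> vertex G0, injective v &
      [/\ 1 < c i, U i = [set x in codom v],
          forall x, #|incident (C i) x| = 2 * (x \in U i)
        & {in U i &, forall x y, connect (adj (C i)) x y}].
    have [c_gt1 [v [e [v_inj e_inj eE CiE]]]] := C_cycle i.
    have inc := card_cycle_incident c_gt1 v_inj e_inj eE; rewrite -CiE in inc.
    have UE : U i = [set x in codom v].
      by apply/setP=> x; rewrite !inE on_cycle_incident inc; case: (_ \in _).
    exists v => //; split=> // [x|x y]; rewrite UE inE ?inc // => xv.
    by rewrite inE CiE; apply: cycle_connected.
  split=> [i x|i|i|i]; have [v v_inj [c_gt1 UE inc conn]] := UP i; rewrite ?CE //.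
  by rewrite UE cardsE card_codom // card_ord.
have [f [f_card f_edge] conn] := connected_spread_coloring card_base conn_base.
exists (fun i => color_class f (Some i)); split; first split=> [i|].
- rewrite -card_U -card_preim_fibre.
  have /set0Pn[v vU] : [set v | p v \in U i] != set0.
    by rewrite -card_gt0 card_preim_fibre muln_gt0 card_U m_gt0 ltnW.
  apply: (connected_2regular_is_cycle vU) => [w|]; last exact: conn.
  by rewrite f_card card_base inE.
- exists (color_class f None); split.
    case: FE => [F0|[oddG0 F1]]; [left | right].
      apply/setP=> e; rewrite inE [RHS]inE; apply/negbTE/negP => fe.
      have /eqP/cards2P[x [y [_ eE]]] := card_ends e.
      have := f_card None x; rewrite FE' F0 (_ : incident set0 _ = set0); last first.
        by apply/setP=> e'; rewrite !inE.
      rewrite cards0 => /cards0_eq/setP/(_ e).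
      by rewrite !inE fe eE set21.
    split=> v; last by have := F1 (p v); rewrite -FE' -f_card.
    suff -> : degree v = degree (p v) by apply: oddG0.
    (* Under a constant colouring the colour degree is the degree, so degrees lift as well. *)
    have := card_incident_lift (fun=> None : option unit) None v.
    rewrite /degree /incident /color_class => eq_deg.
    etransitivity; last etransitivity; [|exact: eq_deg|];
      by apply: eq_card => e; rewrite !inE eqxx.
  move=> e; rewrite inE; case fe: (f e) => [j|] /=.
    rewrite (_ : [set i | _] = [set j]) ?cards1 ?addn0 //.
    by apply/setP=> i; rewrite !inE fe eq_sym.
  rewrite (_ : [set i | _] = set0) ?cards0 //.
  by apply/setP=> i; rewrite !inE fe.
exists P; split=> // B BP v; rewrite -(resP B BP (p v)).
apply: eq_card => i; rewrite !inE; congr (_ && _).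
by rewrite !on_cycle_incident f_card CE.
Qed.

End Spread.

(** * The equipartite graph *)

Lemma cross_edge_other n m (A : {set 'I_n * 'I_m}) v :
  cross_edge A -> v \in A -> exists2 w, v.1 != w.1 & A = [set v; w].
Proof.
case/andP=> /cards2P[x [y [xy ->]]] /forall_inP cross.
have /implyP/(_ xy) xy1 : (x != y) ==> (x.1 != y.1).
  by have /forall_inP := cross x (set21 x y); apply; apply: set22.
case/set2P=> ->; first by exists y.
by exists x; rewrite 1?eq_sym // setUC.
Qed.

Lemma cross_edge2 n m (v w : 'I_n * 'I_m) :
  v.1 != w.1 -> cross_edge [set v; w].
Proof.
move=> vw; rewrite /cross_edge cards2 (_ : v != w) /=; last first.
  by apply: contraNneq vw => ->.
apply/forall_inP=> x xA; apply/forall_inP=> y yA; apply/implyP.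
by case/set2P: xA => ->; case/set2P: yA => ->; rewrite ?eqxx // => _;
  rewrite // eq_sym.
Qed.

Section Equipartite.

Variables (lambda n m : nat).
Hypothesis m_gt0 : 0 < m.
Let G := complete_equipartite_multigraph lambda n m.
Let G0 := complete_multigraph (lambda * m) n.
Implicit Types (A : {set 'I_n * 'I_m}) (v w : vertex G) (e : edge G).

Let part v : vertex G0 := v.1.

Lemma pair_edge_parts A : cross_edge A -> pair_edge [set v.1 | v in A].
Proof.
move=> crA; have /andP[/eqP cA _] := crA;
have /card_gt0P[v vA] : 0 < #|A| by rewrite cA.
have [w vw ->] := cross_edge_other crA vA.
by rewrite /pair_edge imsetU1 imset_set1 cards2 vw.
Qed.

(** The sum is symmetric in the two ends, so edges need no orientation. *)
Definition shift A : 'I_m := Ordinal (ltn_pmod (\sum_(v in A) v.2) m_gt0).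

Definition edge_code (q : 'I_lambda * 'I_m) : 'I_(lambda * m) :=
  cast_ord (etrans (card_prod _ _) (f_equal2 muln (card_ord _) (card_ord _)))
    (enum_rank q).

Lemma edge_code_bij : bijective edge_code.
Proof.
apply: bij_comp; last exact: enum_rank_bij.
by exists (cast_ord (esym (etrans (card_prod _ _)
  (f_equal2 muln (card_ord lambda) (card_ord m)))));
  [apply: cast_ordK | apply: cast_ordKV].
Qed.

(* The [lambda * m] copies of the edge [xy] correspond to the pairs of a copy
   number below [lambda] and a residue [i + j mod m]. *)
Definition project_edge e : edge G0 :=
  exist _ ([set v.1 | v in (val e).1], edge_code ((val e).2, shift (val e).1))
    (pair_edge_parts (valP e)).

Lemma shift2 v w : v.1 != w.1 -> shift [set v; w] = (v.2 + w.2) %% m :> nat.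
Proof.
move=> vw; rewrite /= big_setU1 ?big_set1 // inE.
by apply: contraNneq vw => ->.
Qed.

(** Once the end [(x, i)] is fixed, the residue of [i + j] determines [j], and the image pair
    determines the other part. *)
Lemma project_edge_inj v e e' : v \in ends e -> v \in ends e' ->
  project_edge e = project_edge e' -> e = e'.
Proof.
case: e e' => [[A s] crA] [[A' s'] crA'] vA vA' gE.
have imE : [set x.1 | x in A] = [set x.1 | x in A'] :=
  congr1 (fun d => (val d).1) gE.
have codeE := congr1 (fun d => (val d).2) gE.
have qE : (s, shift A) = (s', shift A') := bij_inj edge_code_bij codeE.
have sE : s = s' := congr1 fst qE.
have shE : shift A = shift A' :> nat := congr1 (fun q => val q.2) qE.
apply: val_inj => /=; rewrite sE; congr (_, _).
have [w vw AE] : exists2 w, v.1 != w.1 & A = [set v; w].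
  exact: cross_edge_other crA vA.
have [w' vw' AE'] : exists2 w', v.1 != w'.1 & A' = [set v; w'].
  exact: cross_edge_other crA' vA'.
have w1 : w.1 = w'.1.
  have : w.1 \in [set x.1 | x in A'] by rewrite -imE AE imset_f ?set22.
  by rewrite AE' imsetU1 imset_set1 => /set2P[] // wv; rewrite wv eqxx in vw.
rewrite AE AE'; congr [set _; _].
move/eqP: shE; rewrite AE AE' !shift2 //.
rewrite eqn_modDl !modn_small // => /eqP w2.
by case: w w' w1 w2 {vw vw' AE AE'} => [x i] [y j] /= -> /val_inj->.
Qed.

Lemma project_edge_lift v (e0 : edge G0) : part v \in ends e0 ->
  exists2 e, v \in ends e & project_edge e = e0.
Proof.
move=> ve0; have [y yv] := ends_other ve0; case: e0 ve0 => [[B t] B2] /= ve0 BE.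
have [q tE] : exists q, t = edge_code q.
  by have [dec _ decK] := edge_code_bij; exists (dec t).
case: q tE => s d tE.
(* The second coordinate solves [i + j = d] modulo [m] for [i = v.2]; the term [m - v.2] stands for
   [-i] and is not truncated. *)
pose w : 'I_n * 'I_m := (y, Ordinal (ltn_pmod (d + (m - v.2)) m_gt0)).
have vw : v.1 != w.1 by rewrite eq_sym.
exists (exist _ ([set v; w], s) (cross_edge2 vw)); first exact: set21.
apply: val_inj; rewrite /= tE [B]BE imsetU1 imset_set1; congr (_, edge_code (_, _)).
apply: ord_inj; rewrite shift2 //= modnDmr addnC -addnA subnK; last exact: ltnW.
by rewrite modnDr modn_small.
Qed.

Lemma card_part x : #|[set v | part v == x]| = m.
Proof.
rewrite (_ : [set v | part v == x] = setX [set x] [set: 'I_m]).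
  by rewrite cardsX cards1 cardsT card_ord mul1n.
by apply/setP=> v; rewrite !inE andbT.
Qed.

(** The transposition preserves first coordinates, hence edges; keeping the copy number makes the
    induced map on edges an involution. *)
Lemma twin_edges u w : u != w -> part u = part w ->
  exists2 pi : edge G -> edge G,
    involutive pi & forall e, ends (pi e) = [set tperm u w v | v in ends e].
Proof.
move=> _ uw.
have cross_pi A : cross_edge A -> cross_edge [set tperm u w v | v in A].
  move=> crA; have /andP[/eqP cA _] := crA.
  have /card_gt0P[v vA] : 0 < #|A| by rewrite cA.
  have tE x : (tperm u w x).1 = x.1 by case: tpermP => // ->.
  have [v' vv' ->] := cross_edge_other crA vA.
  by rewrite imsetU1 imset_set1; apply: cross_edge2; rewrite !tE.
exists (fun e => exist _ ([set tperm u w v | v in (val e).1], (val e).2)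
  (cross_pi _ (valP e))) => // e.
case: e => [[A s] crA]; apply: val_inj => /=; congr (_, _).
rewrite -imset_comp -[RHS]imset_id; apply: eq_imset => v /=; exact: tpermK.
Qed.

Lemma equipartite_resolvable_cycle_decomposition alpha k (c : 'I_k -> nat) :
  admits_resolvable_cycle_decomposition G0 alpha c ->
  admits_resolvable_cycle_decomposition G alpha (fun i => c i * m).
Proof.
apply: (@spread_resolvable_cycle_decomposition G G0 m part project_edge) => //.
- exact: card_part.
- exact: project_edge_inj.
- exact: project_edge_lift.
exact: twin_edges.
Qed.

End Equipartite.

Theorem theorem4p1 (alpha lambda m n : nat)
  (alpha_gt0 : 0 < alpha) (lambda_gt0 : 0 < lambda) (m_gt0 : 0 < m)
  (n_gt0 : 0 < n) (k : nat) (c : 'I_k -> nat) :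
  admits_resolvable_cycle_decomposition
    (complete_multigraph (lambda * m) n) alpha c ->
  admits_resolvable_cycle_decomposition
    (complete_equipartite_multigraph lambda n m) alpha (fun i => c i * m).
Proof. exact: equipartite_resolvable_cycle_decomposition. Qed.
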